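(* Let $v\in\mathbb{N}\setminus\{1\}$ and let $h\colon\mathbb{N}_2\to\mathbb{C}$ be a $v$-transitive convex light weight such that $v\in V(h)$. Suppose that $B_{h,v}(1)_2$ exists and $c=\sum_{n\ge1}|b_n^h|<1$. If $B_{h,v}(x)=B_h(x)$ then $A_{h,v}(x)=0$. If $B_{h,v}(x)\ne B_h(x)$, let $k\in\mathbb{N}_0$ be minimum such that $b_k^{h,v}\ne b_k^h$; if $$\big(|b_k^{h,v}-b_k^h|\cdot(1-c)\big)^{-1}\sum_{n>k}|b_n^{h,v}-b_n^h|<1,$$ then $B_h(1)_2$ exists, $B_h(1)_2\ne0$ and $$\lim_{n\to\infty}a_n^{h,v}\in\mathrm{sqrt}\Big(1-\frac{B_{h,v}(1)_2}{B_h(1)_2}\Big).$$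
   Context: $\mathbb{N}=\{1,2,\dots\}$, $\mathbb{N}_0=\{0,1,2,\dots\}$, and $\mathbb{N}_2=\{e\subset\mathbb{N}:|e|=2\}$. A weight is a map $h\colon\mathbb{N}_2\to\mathbb{C}$. A walk of length $n\in\mathbb{N}_0$ is a tuple $w=\langle v_0,\dots,v_n\rangle$ of elements of $\mathbb{N}$ with $v_{i-1}\ne v_i$ for $i=1,\dots,n$; its weight is $h(w)=\prod_{i=1}^n h(\{v_{i-1},v_i\})$ (and $h(w)=1$ if $n=0$). A series $\sum_{x\in X}g(x)$ over an at most countable set $X$ converges absolutely if the sums $\sum_{x\in Y}|g(x)|$ over finite $Y\subset X$ are bounded. For a set $W$ of walks, $h(W)$ denotes the sum of $\sum_{w\in W}h(w)$ when it converges absolutely. $W(n)$ is the set of walks of length $n$ with $v_0=1$. The weight $h$ is light if $\sum_{w\in W(n)}h(w)$ converges absolutely for every $n\in\mathbb{N}_0$. $V(h)$ is the set of vertices $u\in\mathbb{N}$ such that some walk starting at $1$ and ending at $u$ has nonzero weight. A light weight $h$ is convex if for every $u\in V(h)$, $\sum_{w\in\mathbb{N}\setminus\{u\}}h(\{u,w\})=1$. For $v\in\mathbb{N}\setminus\{1\}$, $h$ is $v$-transitive if there is a bijection $f\colon\mathbb{N}\to\mathbb{N}$ with $f(1)=v$ and $h(\{f(a),f(b)\})=h(\{a,b\})$ for all $\{a,b\}\in\mathbb{N}_2$. Let $a_n^{h,v}=h(W(v,n))$, where $W(v,n)$ is the set of walks in $W(n)$ visiting $v$, and $A_{h,v}(x)=\sum_{n\ge0}a_n^{h,v}x^n$.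 $B_h(x)=\sum_n b_n^hx^n$, $b_n^h$ the weight of walks of length $n$ with $v_0=v_n=1$; $B_{h,v}(x)=\sum_n b_n^{h,v}x^n$, $b_n^{h,v}$ the weight of walks of length $n$ with $v_0=v_n=1$ and $v_i\ne v$ for all $i$. For $U(x)=\sum_{n\ge0}u_nx^n\in\mathbb{C}[[x]]$, we say $U(1)_2$ exists if $\sum_{n\ge0}|u_n|<\infty$, and then $U(1)_2=\sum_{n\ge0}u_n$. For $z\in\mathbb{C}$, $\mathrm{sqrt}(z)=\{\alpha\in\mathbb{C}:\alpha^2=z\}$. *)

(* Defs.v *)
From HB Require Import structures.
From mathcomp Require Import all_boot all_order all_algebra finmap complex.
From mathcomp Require Import all_classical all_reals all_analysis.
From mathcomp Require Import summability.

Set Implicit Arguments.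
Unset Strict Implicit.
Unset Printing Implicit Defensive.

Import Order.TTheory GRing.Theory Num.Theory.
Import numFieldNormedType.Exports.
Import Normc.

Local Open Scope classical_set_scope.
Local Open Scope ring_scope.
Local Open Scope complex_scope.

(* The library puts no topology on R[i]: take the one every numeric field
   carries, induced by the modulus. *)
HB.instance Definition _ (R : realType) := NormedModule.copy R[i] (R[i]^o).

Definition vertex : Type := {n : nat | (0 < n)%N}.
HB.instance Definition _ := Countable.on vertex.

Definition vertex1 : vertex := exist _ 1%N isT.

Definition edge : Type := {e : {fset vertex} | #|` e|%fset == 2%N}.

Definition weight (R : realType) : Type := edge -> R[i].

Definition abs_convergent (R : realType) (T : choiceType) (X : set T)
    (g : T -> R[i]) : Prop :=
  esum.summable X (fun x => (normc (g x))%:E).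

(* Unordered sum, as the limit along the finite subsets of T ordered by
   inclusion; it has the junk value 0 when there is no such limit. *)
Definition csum (R : realType) (T : choiceType) (X : set T)
    (g : T -> R[i]) : R[i] :=
  lim ((fun Y : {fset T} => \sum_(x <- Y | x \in X) g x) @ totally).

(* h({a, b}), extended by 0 to a = b, where {a, b} is not an edge. *)
Definition weight2 (R : realType) (h : weight R) (a b : vertex) : R[i] :=
  if insub [fset a; b]%fset is Some e then h e else 0.

(* <v_0, ..., v_n> is the sequence of its n.+1 vertices. *)
Definition is_walk (w : seq vertex) : bool :=
  (w != [::]) && sorted (fun a b => a != b) w.

Definition walk_length (w : seq vertex) : nat := (size w).-1.

Definition walk_weight (R : realType) (h : weight R) (w : seq vertex) : R[i] :=
  \prod_(i < walk_length w) weight2 h (nth vertex1 w i) (nth vertex1 w i.+1).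

Definition walks_weight (R : realType) (h : weight R)
    (W : set (seq vertex)) : R[i] :=
  csum W (walk_weight h).

Definition rooted_walks (n : nat) : set (seq vertex) :=
  [set w | [/\ is_walk w, walk_length w = n & head vertex1 w = vertex1]].

Definition light_weight (R : realType) (h : weight R) : Prop :=
  forall n, abs_convergent (rooted_walks n) (walk_weight h).

Definition reachable_from1 (R : realType) (h : weight R) : set vertex :=
  [set u | exists w, [/\ is_walk w, head vertex1 w = vertex1, last vertex1 w = u
                       & walk_weight h w != 0]].

Definition convex_weight (R : realType) (h : weight R) : Prop :=
  forall u, reachable_from1 h u -> csum [set w | w != u] (weight2 h u) = 1.

Definition transitive_weight (R : realType) (h : weight R) (v : vertex) : Prop :=
  exists f : vertex -> vertex,
    [/\ bijective f, f vertex1 = v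
      & forall a b, a != b -> weight2 h (f a) (f b) = weight2 h a b].

(* The power series \sum_n u_n x^n is its sequence u of coefficients. *)
Definition fps (R : realType) : Type := nat -> R[i].

Definition A_series (R : realType) (h : weight R) (v : vertex) : fps R :=
  fun n => walks_weight h (rooted_walks n `&` [set w : seq vertex | v \in w]).

Definition B_series (R : realType) (h : weight R) : fps R :=
  fun n => walks_weight h
    (rooted_walks n `&` [set w : seq vertex | last vertex1 w = vertex1]).

Definition B_series_avoiding (R : realType) (h : weight R) (v : vertex) :
    fps R :=
  fun n => walks_weight h
    (rooted_walks n `&`
     [set w : seq vertex | last vertex1 w = vertex1 /\ v \notin w]).

Definition exists_at1 (R : realType) (U : fps R) : Prop :=
  (\sum_(0 <= n <oo) (normc (U n))%:E < +oo)%E.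

Definition value_at1 (R : realType) (U : fps R) : R[i] := limn (series U).

Definition square_roots (R : realType) (z : R[i]) : set R[i] :=
  [set alpha | alpha ^+ 2 = z].

(* Main.v *)
Require Import Defs.
From mathcomp Require Import all_boot all_order all_algebra finmap complex.
From mathcomp Require Import all_classical all_reals all_analysis.
From mathcomp Require Import summability.
From mathcomp Require Import zify.

(** Write B and B_v for the generating functions of closed walks at 1, without
    restriction and avoiding v, and F for that of walks from 1 that end at
    their first visit to v. Cutting a walk at its first visit to v gives
    A = F/(1 - x), since by convexity and transitivity the walks of each length
    from v have total weight 1. The same cut, followed by transitivity, gives
    F B for the walks from 1 to v; applied to the closed walks at 1 visiting v,
    whose second part is a reversed walk from 1 to v, it gives
    B - B_v = F (F B) = F^2 B. So A = 0 if B_v = B. Otherwise let D = B - B_v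
    have order k; then F has order m with k = 2m. As c < 1, the formal square
    root P of B is in l^1, by induction on partial sums: if H^2 = S and
    |S_1| + |S_2| + ... <= |S_0|, then |H_1| + |H_2| + ... <= |H_0|. The smallness
    condition on D gives the same for H = x^-m F P, as H^2 = x^-k D. Hence
    x^-m F B = H P is in l^1, and so is F because c < 1. Thus a_n, a partial sum
    of F(1), converges to F(1), and F(1)^2 B(1) = B(1) - B_v(1). *)

Import Order.TTheory GRing.Theory Num.Theory.
Import numFieldNormedType.Exports.
Import Normc.

Local Open Scope classical_set_scope.
Local Open Scope ring_scope.
Local Open Scope complex_scope.

Set Implicit Arguments.
Unset Strict Implicit.

(* The instance in summability is local to a section that is closed there. *)
#[local] Existing Instance totally_filter.

(** * Unordered complex sums *)

Section UnorderedSums.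
Variable R : realType.
Local Notation C := (R[i]).
Local Notation Re := (@complex.Re R).
Local Notation Im := (@complex.Im R).

Lemma normc_ge0 (x : C) : 0 <= normc x.
Proof. by case: x => a b; exact: sqrtr_ge0. Qed.

Lemma ler_normc_sum (I : Type) (r : seq I) (P : pred I) (F : I -> C) :
  normc (\sum_(i <- r | P i) F i) <= \sum_(i <- r | P i) normc (F i).
Proof.
elim/big_rec2: _ => [|i y x _ xy]; first by rewrite normc0.
by rewrite (le_trans (le_normcD _ _))// lerD2l.
Qed.

Lemma normc_distC (x y : C) : normc (x - y) = normc (y - x).
Proof. by rewrite -normcN opprB. Qed.

Lemma ler_Re_normc (x : C) : `|Re x| <= normc x.
Proof.
by case: x => a b /=; rewrite -sqrtr_sqr ler_wsqrtr// lerDl sqr_ge0.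
Qed.

Lemma ler_Im_normc (x : C) : `|Im x| <= normc x.
Proof.
by case: x => a b /=; rewrite -sqrtr_sqr ler_wsqrtr// lerDr sqr_ge0.
Qed.

Lemma ler_normc_ReIm (x : C) : normc x <= `|Re x| + `|Im x|.
Proof.
case: x => a b /=; rewrite -[leRHS]ger0_norm ?addr_ge0// -sqrtr_sqr.
rewrite ler_wsqrtr// sqrrD !real_normK ?num_real//.
by rewrite addrAC lerDl mulrn_wge0// mulr_ge0.
Qed.

Lemma cvg_normcP (T : Type) (F : set_system T) {FF : Filter F} (f : T -> C)
    (l : C) :
  f @ F --> l <->
  (forall e : R, 0 < e -> \forall t \near F, normc (f t - l) < e).
Proof.
split=> [/cvgrPdist_lt fl e e0|fl].
  have := fl e%:C; rewrite ltcR => /(_ e0); apply: filterS => t.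
  by rewrite normc_distC -ltcR.
apply/cvgrPdist_lt => e e0.
have eE : e = (Re e)%:C by rewrite RRe_real// gtr0_real.
move: e0; rewrite eE ltcR => /fl; apply: filterS => t.
by rewrite normc_distC -ltcR.
Qed.

Lemma complex_hausdorff : hausdorff_space C.
Proof. exact: (@norm_hausdorff _ C). Qed.

Section Families.
Variables (T : choiceType) (X : set T).
Implicit Types (g : T -> C) (Y : {fset T}).

Definition partial_csum g Y := \sum_(x <- Y | x \in X) g x.

(** Unlike a value of [csum], this predicate carries convergence with it, so the default value of a
    limit cannot be mistaken for a sum. *)
Definition has_csum g (s : C) := forall e : R, 0 < e ->
  exists Y0, forall Y, (Y0 `<=` Y)%fset -> normc (partial_csum g Y - s) < e.

Lemma has_csum_cvg g s : has_csum g s <-> partial_csum g @ totally --> s.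
Proof.
split=> [gs|/cvg_normcP gs e /gs [Y0 _ Y0P]]; last by exists Y0.
by apply/cvg_normcP => e /gs[Y0 Y0P]; exists Y0.
Qed.

Lemma has_csum_unique g s1 s2 : has_csum g s1 -> has_csum g s2 -> s1 = s2.
Proof.
move=> /has_csum_cvg gs1 /has_csum_cvg gs2.
exact: (cvg_unique complex_hausdorff gs1 gs2).
Qed.

Lemma has_csumE g s : has_csum g s -> csum X g = s.
Proof. by move=> /has_csum_cvg gs; exact: (cvg_lim complex_hausdorff gs). Qed.

(** Convexity only gives a value of [csum]. The default value being 0, a nonzero value certifies
    convergence. *)
Lemma csum_neq0_has_csum g : csum X g != 0 -> has_csum g (csum X g).
Proof.
move=> g0; apply/has_csum_cvg; case: (pselect (cvg (partial_csum g @ totally))) => // ncvg.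
by move: g0; rewrite /csum (dvgP ncvg) eqxx.
Qed.

Lemma partial_csum_sub Y0 Y (V : zmodType) (f : T -> V) : (Y0 `<=` Y)%fset ->
  \sum_(x <- Y | x \in X) f x = \sum_(x <- Y0 | x \in X) f x
    + \sum_(x <- (Y `\` Y0)%fset | x \in X) f x.
Proof.
move=> Y0Y; rewrite (big_fsetIDcond _ (mem Y0)); congr (_ + _).
  by congr bigop.body; apply/congr1/fsetP => x; rewrite !inE /= andb_idl// => /(fsubsetP Y0Y).
by congr bigop.body; apply/congr1/fsetP => x; rewrite !inE /= andbC.
Qed.

Lemma abs_convergentP g : abs_convergent X g <->
  exists M : R, forall Y, \sum_(x <- Y | x \in X) normc (g x) <= M.
Proof.
have nn x : `|(normc (g x))%:E|%E = (normc (g x))%:E.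
  by rewrite gee0_abs// lee_fin normc_ge0.
rewrite /abs_convergent /esum.summable; split=> [gX|[M gM]].
  exists (fine (\esum_(x in X) `|(normc (g x))%:E|)%E) => Y.
  rewrite -lee_fin fineK; last by rewrite ge0_fin_numE ?esum_ge0.
  apply: esum_ge; exists [set` [fset x in Y | x \in X]%fset].
    split; first exact: finite_fset.
    by move=> x /=; rewrite !inE /= => /andP[_]; rewrite inE.
  rewrite fsbig_finite// set_fsetK -big_fset_condE.
  by under eq_bigr do rewrite nn; rewrite sumEFin.
apply: (@le_lt_trans _ _ M%:E); last exact: ltry.
apply: ge_ereal_sup => _ [A [finA AX] <-].
rewrite fsbig_finite//; under eq_bigr do rewrite nn; rewrite sumEFin lee_fin.
apply: le_trans (gM (fset_set A)); rewrite [leRHS]big_mkcond/=.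
rewrite le_eqVlt; apply/orP; left; apply/eqP/eq_big_seq => x.
by rewrite in_fset_set// inE => /AX xX; rewrite mem_set.
Qed.

(** [Y0] has an absolute sum within [e] of the supremum, which leaves less than [e] for any finite
    set disjoint from it. *)
Lemma abs_convergent_tail g (e : R) : abs_convergent X g -> 0 < e ->
  exists Y0, forall Y, (Y0 `<=` Y)%fset ->
    \sum_(x <- (Y `\` Y0)%fset | x \in X) normc (g x) < e.
Proof.
move=> /abs_convergentP[M gM] e0.
pose S := [set \sum_(x <- Y | x \in X) normc (g x) | Y in [set: {fset T}]].
have S0 : has_sup S.
  split; first by exists (\sum_(x <- fset0 | x \in X) normc (g x)), fset0.
  by exists M => _ [Y _ <-].
have [_ [Y0 _ <-] Y0S] := sup_adherent e0 S0.
exists Y0 => Y Y0Y.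
have : \sum_(x <- Y | x \in X) normc (g x) <= sup S by apply: ub_le_sup; [case: S0|exists Y].
rewrite (partial_csum_sub _ Y0Y) => /le_lt_trans; rewrite ltrBlDr in Y0S.
by move=> /(_ _ Y0S); rewrite ltrD2l.
Qed.

(** Small tails make the finite sums Cauchy; completeness of [R] then gives limits of their real and
    imaginary parts. *)
Lemma abs_convergent_has_csum g : abs_convergent X g -> has_csum g (csum X g).
Proof.
move=> gX.
have cauchyg (e : R) : 0 < e -> exists Y0, forall Y, (Y0 `<=` Y)%fset ->
    normc (partial_csum g Y - partial_csum g Y0) < e.
  move=> /(abs_convergent_tail gX)[Y0 Y0P]; exists Y0 => Y Y0Y.
  rewrite /partial_csum (partial_csum_sub _ Y0Y) addrC addKr.
  exact: le_lt_trans (ler_normc_sum _ _ _) (Y0P _ Y0Y).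
have cvgproj (f : C -> R) : (forall x y, f (x - y) = f x - f y) ->
    (forall x, `|f x| <= normc x) -> cvg (f \o partial_csum g @ totally).
  move=> fB fle; apply: cauchy_cvg; apply: cauchy_exP => e e0.
  have [Y0 Y0P] := cauchyg _ e0.
  exists (f (partial_csum g Y0)), Y0 => // Y /= /Y0P.
  by apply: le_lt_trans; rewrite distrC -fB.
have /cvg_ex[a /cvgrPdist_lt ga] : cvg (Re \o partial_csum g @ totally).
  by apply: cvgproj ler_Re_normc; case=> ? ? [].
have /cvg_ex[b /cvgrPdist_lt gb] : cvg (Im \o partial_csum g @ totally).
  by apply: cvgproj ler_Im_normc; case=> ? ? [].
suff gab : has_csum g (a +i* b) by rewrite (has_csumE gab).
apply/has_csum_cvg/cvg_normcP => e e0.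
have e20 : 0 < e / 2 by rewrite divr_gt0.
apply: filterS2 (ga _ e20) (gb _ e20) => Y.
rewrite [X in _ -> _ -> X < _]/= => gaY gbY.
rewrite (le_lt_trans (ler_normc_ReIm _))// [ltRHS]splitr.
by move: gaY gbY; rewrite /= distrC [in X in _ -> X -> _]distrC;
  case: partial_csum => x y /=; exact: ltrD.
Qed.

Lemma has_csumZ (a : C) g s : has_csum g s -> has_csum (fun x => a * g x) (a * s).
Proof.
move=> gs e e0.
have d0 : 0 < e / (normc a + 1) by rewrite divr_gt0// ltr_wpDl// normc_ge0.
have [Y0 Y0P] := gs _ d0; exists Y0 => Y /Y0P.
rewrite ltr_pdivlMr ?ltr_wpDl ?normc_ge0//; apply: le_lt_trans.
rewrite /partial_csum -mulr_sumr -mulrBr normcM mulrC.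
by rewrite ler_wpM2l ?normc_ge0// lerDl.
Qed.

Lemma has_csum_fset Y g : X = [set` Y] -> has_csum g (\sum_(x <- Y) g x).
Proof.
move=> XY e e0; exists Y => Z YZ.
suff -> : partial_csum g Z = \sum_(x <- Y) g x by rewrite subrr normc0.
rewrite /partial_csum big_fset_condE; congr bigop.body.
apply/congr1/fsetP => x; rewrite !inE /=; apply/andP/idP => [[_]|xY].
  by rewrite XY inE.
by split; [exact: (fsubsetP YZ)|rewrite XY inE].
Qed.

Lemma has_csum_eq g1 g2 s : {in X, g1 =1 g2} -> has_csum g1 s -> has_csum g2 s.
Proof.
move=> g12 gs e /gs[Y0 Y0P]; exists Y0 => Y /Y0P.
by rewrite /partial_csum (eq_bigr g2).
Qed.

End Families.

Lemma abs_convergent_subset (T : choiceType) (X X' : set T) (g : T -> C) :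
  X' `<=` X -> abs_convergent X g -> abs_convergent X' g.
Proof.
move=> X'X /abs_convergentP[M gM]; apply/abs_convergentP; exists M => Y.
apply: le_trans (gM Y); rewrite big_mkcond [leRHS]big_mkcond /= ler_sum// => x _.
case: ifPn => [/set_mem/X'X xX|_]; first by rewrite mem_set.
by case: ifP; rewrite // normc_ge0.
Qed.

(** Regrouping along the fibres of [p]. A finite [Y] that approximates every fibre sum over [Z], cut
    down to the points mapping into [Z], has a sum close both to [s] and to the sum of [g'] over
    [Z]. *)
Lemma has_csum_fibers (T T' : choiceType) (X : set T) (X' : set T')
    (p : T -> T') (g : T -> C) (g' : T' -> C) (s : C) :
  (forall x, X x -> X' (p x)) ->
  (forall t, X' t -> has_csum (X `&` [set x | p x = t]) g (g' t)) ->
  has_csum X g s -> has_csum X' g' s.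
Proof.
move=> XX' gg' gs e e0.
have [Y0 Y0P] := gs _ (divr_gt0 e0 (ltr0Sn _ 1)).
exists (p @` Y0)%fset => Z Y0Z.
(* One error [d] per element of [Z] adds up to at most [e / 2]; the successor avoids a division by
   zero when [Z] is empty. *)
pose d : R := e / 2 / (size Z).+1%:R.
have d0 : 0 < d by rewrite !divr_gt0.
pose fib t := X `&` [set x | p x = t].
have : totally (\bigcap_(t in [set` Z])
    [set Y | X' t -> normc (partial_csum (fib t) g Y - g' t) < d]).
  apply: filter_bigI => t tZ; have [X't|nX't] := pselect (X' t).
    by have [Y1 Y1P] := gg' _ X't _ d0; exists Y1 => // Y /= /Y1P gY _; exact: gY.
  by exists fset0 => // Y _ /nX't.
move=> [Y1 _ Y1P].
have {Y1P}YP := Y1P (Y0 `|` Y1)%fset (fsubsetUr _ _).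
set Y := (Y0 `|` Y1)%fset in YP.
pose Y' := [fset x in Y | (x \in X) ==> (p x \in Z)]%fset.
have gY' : partial_csum X g Y' = \sum_(t <- Z | t \in X') partial_csum (fib t) g Y.
  transitivity (\sum_(x <- Y | x \in X) \sum_(t <- Z | p x == t) g x).
    rewrite /partial_csum big_mkcond -big_fset_condE.
    rewrite [LHS]big_mkcond [RHS]big_mkcond /=.
    apply: eq_bigr => x _; case: (boolP (x \in X)) => xX //=.
    case: (boolP (p x \in Z)) => pxZ /=.
      under eq_bigl do rewrite eq_sym.
      by rewrite (@fbig_pred1_inj _ _ _ _ _ (fun=> g x) id) ?implybT.
    rewrite big_seq_cond big1// => t /andP[tZ /eqP pt].
    by rewrite pt tZ in pxZ.
  under [RHS]eq_bigr do rewrite /partial_csum big_mkcond/=.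
  under [LHS]eq_bigr do rewrite big_mkcond/=.
  rewrite [LHS]big_mkcond/= [RHS]big_mkcond/=.
  rewrite (eq_bigr (fun t => \sum_(x <- Y) if x \in fib t then g x else 0)); last first.
    move=> t _; case: ifPn => // tX'; rewrite big1// => x _; case: ifPn => //.
    by move=> /set_mem[/XX' + pxt]; rewrite pxt => X't; rewrite mem_set in tX'.
  rewrite exchange_big/=; apply: eq_bigr => x _.
  case: ifPn => xX.
    apply: eq_bigr => t _; congr (if _ then _ else _).
    by apply/eqP/idP => [pxt|/set_mem[]//]; rewrite mem_set//; split=> //; exact: set_mem.
  rewrite big1// => t _; case: ifPn => // /set_mem[Xx].
  by rewrite mem_set in xX.
have : normc (partial_csum X g Y' - s) < e / 2.
  (* The points of [Y0] in [X] map into [Z], so joining [Y0] to [Y'] adds no term. *)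
  pose Y2 := (Y0 `|` Y')%fset.
  suff -> : partial_csum X g Y' = partial_csum X g Y2 by apply: Y0P; exact: fsubsetUl.
  rewrite /partial_csum [LHS]big_fset_condE [RHS]big_fset_condE; congr bigop.body.
  apply/congr1/fsetP => x; rewrite !inE /=.
  case: (boolP (x \in X)) => /=; rewrite ?andbF// !andbT => xX.
  case: (boolP (x \in Y0)) => //= xY0.
  by apply: (fsubsetP Y0Z); exact: in_imfset.
rewrite gY' => gYs.
rewrite -[X in normc X](subrKA (\sum_(t <- Z | t \in X') partial_csum (fib t) g Y)).
rewrite (le_lt_trans (le_normcD _ _))// [ltRHS]splitr ler_ltD//.
rewrite /partial_csum -sumrB (le_trans (ler_normc_sum _ _ _))//.
apply: (@le_trans _ _ (\sum_(t <- Z) d)).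
  rewrite big_mkcond/= big_seq [leRHS]big_seq; apply: ler_sum => t tZ.
  case: ifPn => [/set_mem tX'|_]; last exact: ltW.
  by rewrite normc_distC ltW// YP.
rewrite big_const_seq count_predT iter_addr_0 -[leLHS]mulr_natr /d.
rewrite mulrAC ler_pdivrMr// ler_wpM2l ?ler_nat//.
by rewrite divr_ge0// ltW.
Qed.

(** Regrouping along [p], whose fibres in [X] are the singletons of the [q t]. *)
Lemma has_csum_bij (T T' : choiceType) (X : set T) (X' : set T')
    (p : T -> T') (q : T' -> T) (g : T -> C) (g' : T' -> C) (s : C) :
  (forall x, X x -> X' (p x)) -> (forall t, X' t -> X (q t)) ->
  (forall x, X x -> q (p x) = x) -> (forall t, X' t -> p (q t) = t) ->
  (forall x, X x -> g' (p x) = g x) ->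
  has_csum X g s -> has_csum X' g' s.
Proof.
move=> pX qX qp pq gg'; apply: (has_csum_fibers pX) => t X't.
have -> : g' t = \sum_(x <- [fset q t]%fset) g x.
  by rewrite big_seq_fset1 -gg' ?pq//; exact: qX.
apply: has_csum_fset; apply/seteqP; split=> x /=; rewrite !inE.
  by move=> [Xx <-]; rewrite qp.
by move=> /eqP->; split; [exact: qX|exact: pq].
Qed.

Lemma abs_convergent_bij (T T' : choiceType) (X : set T) (X' : set T')
    (q : T' -> T) (g : T -> C) (g' : T' -> C) :
  (forall t, X' t -> X (q t)) -> injective q ->
  (forall t, X' t -> g (q t) = g' t) ->
  abs_convergent X g -> abs_convergent X' g'.
Proof.
move=> qX qI gg' /abs_convergentP[M gM]; apply/abs_convergentP; exists M => Y.
pose Y' := [fset x in Y | x \in X']%fset.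
apply: le_trans (gM (q @` Y')%fset).
rewrite [leRHS]big_mkcond [leRHS]big_imfset/=; last by move=> ? ? _ _ /qI.
rewrite -big_fset_condE/=; apply: ler_sum => t /set_mem X't.
by rewrite mem_set ?gg'//; exact: qX.
Qed.

End UnorderedSums.

(** * Walks *)

Section Walks.
Variables (R : realType) (h : weight R).
Local Notation C := (R[i]).
Local Notation ww := (walk_weight h).
Implicit Types (a b v : vertex) (u t w : seq vertex).

Definition walks_from a n : set (seq vertex) :=
  [set w | [/\ is_walk w, walk_length w = n & head vertex1 w = a]].

(** A walk of length [n] has [n.+1] entries, and [index] returns that size if [v] is absent. So the
    condition puts [v] at the last entry and nowhere before. *)
Definition first_passages a v n : set (seq vertex) :=
  walks_from a n `&` [set w : seq vertex | index v w = n].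

Lemma weight2C a b : weight2 h a b = weight2 h b a.
Proof. by rewrite /weight2 fsetUC. Qed.

Lemma walk_weight1 a : ww [:: a] = 1.
Proof. by rewrite /walk_weight big_ord0. Qed.

Lemma walk_weight_cons a b w : ww [:: a, b & w] = weight2 h a b * ww (b :: w).
Proof. by rewrite /walk_weight /walk_length /= big_ord_recl. Qed.

(** The cut vertex [v] belongs to both pieces, so no edge is lost. *)
Lemma walk_weight_cat u v t :
  ww (rcons u v ++ t) = ww (rcons u v) * ww (v :: t).
Proof.
elim: u => [|a [|b u] IHu]; first by rewrite walk_weight1 mul1r.
  by rewrite /= !walk_weight_cons walk_weight1 mulr1.
by move: IHu; rewrite /= !walk_weight_cons => ->; rewrite mulrA.
Qed.

Lemma walk_weight_rcons w b : w != [::] ->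
  ww (rcons w b) = ww w * weight2 h (last vertex1 w) b.
Proof.
case/lastP: w => // u v _; rewrite -cats1 walk_weight_cat last_rcons.
by rewrite walk_weight_cons walk_weight1 mulr1.
Qed.

Lemma walk_weight_rev w : ww (rev w) = ww w.
Proof.
elim: w => [|a [|b w] IHw] //; rewrite rev_cons walk_weight_rcons; last first.
  by rewrite -size_eq0 size_rev.
by rewrite IHw walk_weight_cons rev_cons last_rcons mulrC weight2C.
Qed.

Lemma is_walk_cat u v t : is_walk (rcons u v ++ t) = is_walk (rcons u v) && is_walk (v :: t).
Proof.
by case: u => [|a u] //; rewrite /is_walk /= cat_path last_rcons.
Qed.

Lemma is_walk_rev w : is_walk (rev w) = is_walk w.
Proof.
rewrite /is_walk -!size_eq0 size_rev rev_sorted; congr (_ && _).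
by apply: eq_sorted => a b /=; rewrite eq_sym.
Qed.

Lemma head_rcons_cat u v t : head vertex1 (rcons u v ++ t) = head vertex1 (rcons u v).
Proof. by case: u. Qed.

Lemma first_passage_rcons a v n w : first_passages a v n w ->
  exists u, [/\ w = rcons u v, v \notin u & size u = n].
Proof.
move=> [[+ + _] /= wn]; case/lastP: w wn => // u b + _.
rewrite /walk_length size_rcons /= => + un; rewrite -cats1 index_cat.
case: ifPn => [vu ui|vu].
  by move: vu; rewrite -index_mem ui un ltnn.
rewrite /= un; case: eqP => [->|_]; first by exists u; rewrite cats1.
by move=> /eqP; rewrite eqn_leq addn1 ltnn.
Qed.

Lemma split_at_index v w n : v \in w -> index v w = n ->
  [/\ take n.+1 w = rcons (take n w) v, drop n w = v :: drop n.+1 w,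
      size (take n w) = n & v \notin take n w].
Proof.
move=> vw wn; have nw : (n < size w)%N by rewrite -wn index_mem.
have vE : nth v w n = v by rewrite -wn nth_index.
split; first by rewrite (take_nth v)// vE.
- by rewrite (drop_nth v)// vE.
- by rewrite size_takel// ltnW.
- by rewrite -wn; apply/negP => /index_ltn; rewrite ltnn.
Qed.

Lemma has_csum_ord (g : nat -> C) n :
  has_csum [set i | (i < n)%N] g (\sum_(i < n) g i).
Proof.
have -> : \sum_(i < n) g i = \sum_(i <- [fset val i | i in 'I_n]%fset) g i.
  by rewrite big_imfset/=; [rewrite big_enum|move=> ? ? _ _ /val_inj].
apply: has_csum_fset; apply/seteqP; split=> i /=.
  by move=> ni; apply/imfsetP; exists (Ordinal ni).
by move=> /imfsetP[j _ ->].
Qed.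

(** Two nested regroupings: by the time [i] of the first visit to [v], then by the piece up to that
    visit. With this piece fixed, the rest ranges over all walks of length [n - i] from [v] that end
    in [Q]. *)
Lemma csum_first_passage (Q : set vertex) a v n :
  (forall m, abs_convergent (walks_from a m) ww) ->
  (forall m, abs_convergent (walks_from v m) ww) ->
  csum (walks_from a n `&` [set w : seq vertex | v \in w /\ Q (last vertex1 w)]) ww =
  \sum_(i < n.+1) csum (first_passages a v i) ww *
    csum (walks_from v (n - i) `&` [set w : seq vertex | Q (last vertex1 w)]) ww.
Proof.
move=> absa absv; set X := (X in csum X ww = _).
have absX Y : Y `<=` X -> has_csum Y ww (csum Y ww).
  move=> YX; apply/abs_convergent_has_csum/(abs_convergent_subset _ (absa n)).
  by move=> w /YX[].
pose T i := csum (walks_from v i `&` [set w : seq vertex | Q (last vertex1 w)]) ww.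
have hasT i : has_csum (walks_from v i `&` [set w : seq vertex | Q (last vertex1 w)]) ww (T i).
  by apply/abs_convergent_has_csum/(abs_convergent_subset _ (absv i)) => w [].
pose f i := csum (first_passages a v i) ww.
have hasf i : has_csum (first_passages a v i) ww (f i).
  by apply/abs_convergent_has_csum/(abs_convergent_subset _ (absa i)) => w [].
rewrite -/X; apply: has_csum_unique (has_csum_ord (fun i => f i * T (n - i)%N) _).
(* Outer regrouping, by the time of the first visit. *)
apply: (@has_csum_fibers _ _ _ X _ (index v)) (absX X _) => //.
  by move=> w [[_ wn _] [vw _]] /=; rewrite -wn /walk_length -index_mem in vw *;
     rewrite (leq_trans vw)// leqSpred.
move=> i /=; rewrite ltnS => ilen; set Xi := _ `&` _.
have XiX : Xi `<=` X by move=> w [].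
suff -> : f i * T (n - i)%N = csum Xi ww by exact: absX.
(* The product is itself an unordered sum over first passages, each multiplied by the total weight
   of its continuations. *)
have fT : has_csum (first_passages a v i) (fun w => ww w * T (n - i)%N) (f i * T (n - i)%N).
  by rewrite mulrC; apply: has_csum_eq (has_csumZ _ (hasf i)) => w _; exact: mulrC.
apply: (has_csum_unique fT).
(* Inner regrouping, by the first [i.+1] vertices. *)
apply: (@has_csum_fibers _ _ _ Xi _ (take i.+1) ww) (absX Xi XiX).
  move=> w [[[wW wn wa] [vw _]] /= wi].
  have [tE dE ti vti] := split_at_index vw wi.
  have wE : w = rcons (take i w) v ++ drop i.+1 w by rewrite -tE cat_take_drop.
  split; first split.
  - by move: wW; rewrite {1}wE is_walk_cat tE => /andP[].
  - by rewrite tE /walk_length size_rcons ti.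
  - by rewrite tE -wa [in RHS]wE head_rcons_cat.
  - by rewrite /= tE -cats1 index_cat (negbTE vti) /= eqxx addn0.
move=> w1 aw1; have [u [uE vu ui]] := first_passage_rcons aw1; rewrite {w1}uE in aw1 *.
set Xw := _ `&` _; have XwX : Xw `<=` X by move=> w [/XiX].
have XwE w : Xw w -> exists2 t, w = rcons u v ++ t & size t = (n - i)%N.
  move=> [[[[_ wn _] _] _] /= wu]; exists (drop i.+1 w).
    by rewrite -wu cat_take_drop.
  by rewrite size_drop -wn /walk_length; lia.
have cutE t : [/\ index v (rcons u v ++ t) = i, take i.+1 (rcons u v ++ t) = rcons u v
    & drop i (rcons u v ++ t) = v :: t].
  split.
  - by rewrite cat_rcons index_cat (negbTE vu) /= eqxx addn0.
  - by rewrite take_size_cat// size_rcons ui.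
  - by rewrite cat_rcons drop_size_cat.
have consE t : walks_from v (n - i) t -> exists t', t = v :: t'.
  by move=> [+ _]; case: t => // b t _ /= ->; exists t.
have XwT t : Xw (rcons u v ++ t) <->
    (walks_from v (n - i) `&` [set w : seq vertex | Q (last vertex1 w)]) (v :: t).
  have [iE tE dE] := cutE t; case: aw1 => [[uW un uh] _]; split.
    move=> [[[[+ + _] [_ +]] _] _]; rewrite is_walk_cat /walk_length size_cat size_rcons ui.
    move=> /andP[_ vW] tn; rewrite last_cat last_rcons => Qt; split=> //; split=> //.
    by rewrite /walk_length /=; lia.
  move=> [[vW tn _] Qt]; split; last exact: tE.
  split; last exact: iE.
  split; first split.
  - by rewrite is_walk_cat uW.
  - by move: tn; rewrite /walk_length size_cat size_rcons ui /=; lia.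
  - by rewrite head_rcons_cat.
  - by rewrite /= mem_cat mem_rcons inE eqxx last_cat last_rcons.
suff -> : ww (rcons u v) * T (n - i)%N = csum Xw ww by exact: absX.
apply: has_csum_unique (has_csumZ _ (hasT (n - i)%N)) _.
(* Dropping [i] entries keeps the shared vertex [v]; the inverse map removes it from the second
   piece before gluing. *)
apply: (@has_csum_bij _ _ _ Xw _ (drop i) (fun t => rcons u v ++ behead t) ww).
- move=> w wX; have [t wE _] := XwE _ wX.
  by have [_ _] := cutE t; rewrite -wE => ->; apply/XwT; rewrite -wE.
- by move=> t [/[dup] tW /consE[t' tE]]; rewrite tE in tW *; move=> Qt; apply/XwT.
- by move=> w /XwE[t -> _]; have [_ _ ->] := cutE t.
- by move=> t [/consE[t' ->] _] /=; have [_ _ ->] := cutE t'.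
- by move=> w /XwE[t -> _]; have [_ _ ->] := cutE t; rewrite walk_weight_cat.
- exact: absX.
Qed.

(** Induction on [n]: walks of length [n.+1] are grouped by their first [n.+1] vertices, and
    convexity at the end of the shortened walk makes each group sum to the weight of that walk. *)
Lemma csum_walks_convex n :
  light_weight h -> convex_weight h -> csum (walks_from vertex1 n) ww = 1.
Proof.
move=> light convex; elim: n => [|n IHn].
  have <- : \sum_(w <- [fset [:: vertex1]]%fset) ww w = 1.
    by rewrite big_seq_fset1 walk_weight1.
  apply/has_csumE/has_csum_fset/seteqP; split=> w /=; rewrite !inE.
    by move=> [wW]; case: w wW => [|b [|? ?]]// _ _ /= ->.
  by move=> /eqP->.
rewrite -[RHS]IHn; apply/esym/has_csumE.
apply: (@has_csum_fibers _ _ _ (walks_from vertex1 n.+1) _ (take n.+1) ww); last first.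
- exact/abs_convergent_has_csum/light.
- move=> w wn; have [wW wl wh] := wn.
  have wS : size w = n.+1 by move: wW wl; case: (w) => //= b t _ <-.
  have w0 : w != [::] by rewrite -size_eq0 wS.
  set X := _ `&` _.
  have absX : has_csum X ww (csum X ww).
    by apply/abs_convergent_has_csum/(abs_convergent_subset _ (light n.+1)) => ? [].
  suff -> : ww w = csum X ww by [].
  have XE x : X x -> exists2 b, x = rcons w b & b != last vertex1 w.
    move=> [[xW xn xh] /= xw].
    have xS : size x = n.+2 by move: xW xn; case: (x) => //= b t _ <-.
    move: xW; rewrite -(cat_take_drop n.+1 x) xw.
    have : size (drop n.+1 x) = 1%N by rewrite size_drop xS subSnn.
    case: (drop n.+1 x) => [|b [|]]// _; rewrite cats1 => xW; exists b => //.
    move: xW; case/lastP: (w) w0 => // u c _; rewrite -(cats1 _ b) is_walk_cat last_rcons.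
    by move=> /andP[_]; rewrite /is_walk /= andbT eq_sym.
  have XwE b : b != last vertex1 w -> X (rcons w b).
    move=> bw; split; last by rewrite /= -cats1 take_size_cat.
    split.
    - move: bw wW; case/lastP: (w) w0 => // u c _; rewrite -(cats1 _ b).
      rewrite is_walk_cat last_rcons => bc ->.
      by rewrite /is_walk /= andbT eq_sym.
    - by rewrite /walk_length size_rcons wS.
    - by case: (w) w0 wh.
  have sX : has_csum [set b | b != last vertex1 w]
      (fun b => ww w * weight2 h (last vertex1 w) b) (csum X ww).
    apply: (@has_csum_bij _ _ _ X _ (last vertex1) (rcons w) ww) absX.
    - by move=> x /XE[b -> bw]; rewrite /= last_rcons.
    - exact: XwE.
    - by move=> x /XE[b -> bw]; rewrite last_rcons.
    - by move=> b _; rewrite last_rcons.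
    - by move=> x /XE[b -> bw]; rewrite last_rcons walk_weight_rcons.
  apply: has_csum_unique sX.
  (* A walk of weight 0 may end at an unreachable vertex, where convexity says nothing; its group
     then sums to 0 term by term. *)
  have [ww0|ww0] := eqVneq (ww w) 0.
    move=> e e0; exists fset0 => Y _; rewrite /partial_csum ww0.
    by rewrite big1 ?subrr ?normc0// => b _; rewrite mul0r.
  have c1 : csum [set b | b != last vertex1 w] (weight2 h (last vertex1 w)) = 1.
    by apply: convex; exists w.
  rewrite -[X in has_csum _ _ X]mulr1; apply: has_csumZ.
  by rewrite -c1; apply: csum_neq0_has_csum; rewrite c1 oner_neq0.
- move=> w [wW wl wh].
  have wS : size w = n.+2 by move: wW wl; case: (w) => //= b t _ <-.
  split.
  - move: wW; rewrite -{1}(cat_take_drop n.+1 w).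
    have : size (take n.+1 w) = n.+1 by rewrite size_takel// wS.
    by case/lastP: (take n.+1 w) => // u b _; rewrite is_walk_cat => /andP[].
  - by rewrite /walk_length size_takel// wS.
  - by move: wh; case: (w).
Qed.

Lemma B_series0 : B_series h 0%N = 1.
Proof.
have <- : \sum_(w <- [fset [:: vertex1]]%fset) ww w = 1.
  by rewrite big_seq_fset1 walk_weight1.
apply/has_csumE/has_csum_fset/seteqP; split=> w /=; rewrite !inE.
  by move=> [[wW]]; case: w wW => [|b [|? ?]]// _ _ /= ->.
by move=> /eqP->.
Qed.

(** Edges are unordered, so reversing a walk preserves its weight. *)
Lemma csum_walks_rev (v : vertex) n : abs_convergent (walks_from v n) ww ->
  csum (walks_from v n `&` [set w : seq vertex | last vertex1 w = vertex1]) ww =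
  csum (walks_from vertex1 n `&` [set w : seq vertex | last vertex1 w = v]) ww.
Proof.
move=> absv; have revE a b w : (walks_from a n `&` [set w : seq vertex | last vertex1 w = b]) w ->
    (walks_from b n `&` [set w : seq vertex | last vertex1 w = a]) (rev w).
  move=> [[wW wn wa] /= wb]; split; first split.
  - by rewrite is_walk_rev.
  - by rewrite /walk_length size_rev.
  - by rewrite -wb; case/lastP: (w) => // u c; rewrite rev_rcons last_rcons.
  - by rewrite /= -wa; case: (w) => // c u; rewrite rev_cons last_rcons.
apply/esym/has_csumE.
apply: (@has_csum_bij _ _ _ _ _ rev rev ww) (abs_convergent_has_csum _) => //.
- by move=> w /revE.
- by move=> w /revE.
- by move=> w _; rewrite revK.
- by move=> w _; rewrite revK.
- by move=> w _; rewrite walk_weight_rev.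
- by apply: abs_convergent_subset absv => w [].
Qed.

Lemma walks_from_map (f f' : vertex -> vertex) a n w : cancel f f' ->
  walks_from a n w -> walks_from (f a) n (map f w).
Proof.
move=> fK [wW wn wa]; split.
- move: wW; rewrite /is_walk -!size_eq0 size_map sorted_map; congr (_ && _).
  by apply: eq_sorted => b c /=; rewrite (can_eq fK).
- by rewrite /walk_length size_map.
- by rewrite -wa; move: wW; case: w {wn wa}.
Qed.

(** * Invariance under a weight-preserving bijection of the vertices *)

Section Transitive.
Variables (f f' : vertex -> vertex).
Hypotheses (fK : cancel f f') (f'K : cancel f' f).
Hypothesis hf : forall a b, a != b -> weight2 h (f a) (f b) = weight2 h a b.

(** [hf] concerns distinct vertices; this settles equal neighbours, so that [walk_weight_map] holds
    for arbitrary sequences. *)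
Lemma weight2_diag a : weight2 h a a = 0.
Proof. by rewrite /weight2 insubF// fsetUid cardfs1. Qed.

Lemma walk_weight_map w : ww (map f w) = ww w.
Proof.
elim: w => [|a [|b w] IHw]; rewrite ?walk_weight1// [map _ _]/= !walk_weight_cons.
rewrite IHw; have [->|ab] := eqVneq a b; last by rewrite hf.
by rewrite !weight2_diag.
Qed.

Lemma walk_weight_map_inv w : ww (map f' w) = ww w.
Proof. by rewrite -walk_weight_map mapK. Qed.

Lemma abs_convergent_walks_map a n :
  abs_convergent (walks_from a n) ww -> abs_convergent (walks_from (f a) n) ww.
Proof.
apply: (@abs_convergent_bij _ _ _ _ _ (map f')) => [w||w _].
- by move=> /(walks_from_map f'K); rewrite fK.
- exact/inj_map/(can_inj f'K).
- exact: walk_weight_map_inv.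
Qed.

Lemma csum_walks_map (Q : set vertex) a n : abs_convergent (walks_from a n) ww ->
  csum (walks_from (f a) n `&` [set w : seq vertex | Q (last vertex1 w)]) ww =
  csum (walks_from a n `&` [set w : seq vertex | Q (f (last vertex1 w))]) ww.
Proof.
move=> absa; apply: has_csumE.
have lastE g b w : is_walk w -> last vertex1 (map g w) = g (last vertex1 w).
  by case: w => // c w _; rewrite /= last_map.
apply: (@has_csum_bij _ _ _ _ _ (map f) (map f') ww) (abs_convergent_has_csum _) => //.
- move=> w [wa Qw]; split; first exact: walks_from_map fK wa.
  by case: wa => wW _ _; rewrite /= lastE.
- move=> w [wa Qw]; split; first by rewrite -[a]fK; exact: walks_from_map f'K wa.
  by case: wa => wW _ _; rewrite /= lastE// f'K.
- by move=> w _; rewrite mapK.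
- by move=> w _; rewrite mapK.
- by move=> w _; rewrite walk_weight_map.
- by apply: abs_convergent_subset absa => w [].
Qed.
End Transitive.

(** Regrouping along the boolean [x \in A]. *)
Lemma csum_split (T : choiceType) (X A : set T) (g : T -> C) :
  abs_convergent X g ->
  csum X g = csum (X `&` A) g + csum (X `\` A) g.
Proof.
move=> absX.
have absXY Y : Y `<=` X -> has_csum Y g (csum Y g).
  by move=> YX; exact/abs_convergent_has_csum/(abs_convergent_subset YX).
pose g' (x : bool) := if x then csum (X `&` A) g else csum (X `\` A) g.
have -> : csum (X `&` A) g + csum (X `\` A) g = \sum_(x <- [fset true; false]%fset) g' x.
  by rewrite big_fsetU1 ?inE//= big_seq_fset1.
have gT : has_csum setT g' (csum X g).
  apply: (@has_csum_fibers _ _ _ X _ (fun x => x \in A) g) (absXY _ _) => //.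
  move=> [] _ /=.
    have -> : X `&` [set x | (x \in A) = true] = X `&` A.
      by apply/seteqP; split=> x [Xx /= xA]; split=> //=; [exact: set_mem|exact: mem_set].
    by apply: absXY => x [].
  have -> : X `&` [set x | (x \in A) = false] = X `\` A.
    apply/seteqP; split=> x [Xx /= xA]; split=> //=; last exact: memNset.
    by move=> Ax; rewrite mem_set in xA.
  by apply: absXY => x [].
apply: (has_csum_unique gT); apply: has_csum_fset.
by apply/seteqP; split=> [[]|] //= _; rewrite !inE.
Qed.

Definition first_passage_series v : fps R :=
  fun n => csum (first_passages vertex1 v n) ww.

(** The Green function from 1 to [v], graded by length: in contrast to [first_passage_series],
    earlier visits to [v] are allowed. *)
Definition hitting_series v : fps R :=
  fun n => csum (walks_from vertex1 n `&` [set w : seq vertex | last vertex1 w = v]) ww.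

(** Three cases of [csum_first_passage]: endpoint free, equal to [v], equal to 1. After the cut, [f]
    carries the walks from [v] back to walks from 1 in the first two cases; the third uses
    reversal. *)
Lemma first_passage_identities v :
  transitive_weight h v -> light_weight h -> 
  [/\ convex_weight h -> forall n,
       A_series h v n = \sum_(i < n.+1) first_passage_series v i,
     forall n, hitting_series v n =
       \sum_(i < n.+1) first_passage_series v i * B_series h (n - i)%N
   & forall n, B_series h n - B_series_avoiding h v n =
       \sum_(i < n.+1) first_passage_series v i * hitting_series v (n - i)%N].
Proof.
move=> [f [[f' fK f'K] f1 hf]] light.
have absv m : abs_convergent (walks_from v m) ww.
  by rewrite -f1; exact: abs_convergent_walks_map (light m).
have abs1 m : abs_convergent (walks_from vertex1 m) ww by exact: light.
split.
- move=> convex n.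
  have := csum_first_passage setT n light absv.
  rewrite [X in csum X](_ : _ = rooted_walks n `&` [set w : seq vertex | v \in w]).
    rewrite /A_series /walks_weight => ->; apply: eq_bigr => i _.
    rewrite -f1 (csum_walks_map fK f'K hf setT (abs1 _)).
    by rewrite setIT csum_walks_convex// mulr1.
  by apply/seteqP; split=> w [/= wn]; [case|]; split.
- move=> n; have := csum_first_passage [set v] n light absv.
  rewrite [X in csum X](_ : _ = walks_from vertex1 n `&` [set w : seq vertex | last vertex1 w = v]).
    rewrite /hitting_series => ->; apply: eq_bigr => i _; congr (_ * _).
    rewrite -[in walks_from v _]f1 (csum_walks_map fK f'K hf [set v] (abs1 _)).
    congr csum; apply/seteqP; split=> w [wn /= wv]; split=> //=.
      by apply: (can_inj fK); rewrite wv.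
    by rewrite wv.
  apply/seteqP; split=> w [wn /= wv]; split=> //=; first by case: wv.
  by split=> //; case: wn => + _ _; case: w wv => // b w <- _; rewrite /= mem_last.
- move=> n; have := csum_first_passage [set vertex1] n light absv.
  rewrite /B_series /B_series_avoiding /walks_weight.
  (* Removing the closed walks that avoid [v] leaves those that visit it. *)
  rewrite (@csum_split _ (_ `&` [set w | last vertex1 w = vertex1])
    [set w : seq vertex | v \in w]); last first.
    by apply: abs_convergent_subset (light n) => w [].
  set X := (X in csum X _ = _); rewrite [X in csum X _ + _](_ : _ = X); last first.
    by apply/seteqP; split=> w /= => [[[wn w1] vw]|[wn [vw w1]]].
  rewrite [X in _ + csum X _ - _](_ : _ = rooted_walks n `&`
      [set w : seq vertex | last vertex1 w = vertex1 /\ v \notin w]); last first.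
    apply/seteqP; split=> w /= => [[[wn w1] vw]|[wn [w1 vw]]]; split=> //=.
      by split=> //; apply/negP.
    exact/negP.
  rewrite addrK => ->; apply: eq_bigr => i _; congr (_ * _).
  exact: csum_walks_rev.
Qed.

End Walks.

(** * Formal power series with summable coefficients *)

Section PowerSeries.
Variable R : realType.
Local Notation C := (R[i]).
Implicit Types (U V W H S : fps R) (n m N : nat).

Definition conv U V : fps R := fun n => \sum_(i < n.+1) U i * V (n - i)%N.

Definition shift m U : fps R := fun n => U (m + n)%N.

Definition l1 U := exists M : R, forall N, \sum_(n < N) normc (U n) <= M.

(** Coefficients below [N] depend only on truncations, so [conv] inherits commutativity and
    associativity from polynomials. *)
Lemma conv_poly U V n N : (n < N)%N ->
  conv U V n = ((\poly_(i < N) U i) * (\poly_(i < N) V i))`_n.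
Proof.
move=> nN; rewrite coefM; apply: eq_bigr => i _; rewrite !coef_poly.
by rewrite (leq_ltn_trans (leq_subr _ _) nN) (leq_ltn_trans _ nN)// -ltnS.
Qed.

Lemma convC U V : conv U V = conv V U.
Proof. by apply/funext => n; rewrite !(conv_poly _ _ (ltnSn n)) mulrC. Qed.

Lemma convA U V W : conv U (conv V W) = conv (conv U V) W.
Proof.
apply/funext => n; pose t U := \poly_(i < n.+1) U i.
have tE U' i : (i < n.+1)%N -> (t U')`_i = U' i by move=> ni; rewrite coef_poly ni.
have -> : conv U (conv V W) n = (t U * (t V * t W))`_n.
  rewrite coefM; apply: eq_bigr => i _; rewrite tE//.
  by rewrite -conv_poly// ltnS leq_subr.
have -> : conv (conv U V) W n = ((t U * t V) * t W)`_n.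
  rewrite coefM; apply: eq_bigr => i _; rewrite tE ?ltnS ?leq_subr//.
  by rewrite -conv_poly.
by rewrite mulrA.
Qed.

Lemma conv0 U V : conv U V 0%N = U 0%N * V 0%N.
Proof. by rewrite /conv big_ord_recl big_ord0 addr0. Qed.

(** Isolates the two end terms, which contain [H n.+1]; the others involve only [H 1] to [H n]. Both
    the construction of square roots and the bound in [l1_sqrt] solve this for [H n.+1]. *)
Lemma conv_sqrS H n :
  conv H H n.+1 = 2 * H 0%N * H n.+1 + \sum_(i < n) H i.+1 * H (n - i)%N.
Proof.
rewrite /conv big_ord_recl big_ord_recr/= subn0 subnn.
rewrite [in RHS]mulrDl !mul1r mulrDl addrAC -addrA; congr (_ + _).
by congr (_ + _); exact: mulrC.
Qed.

Lemma conv_shift m U V : (forall j, (j < m)%N -> U j = 0) ->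
  shift m (conv U V) = conv (shift m U) V.
Proof.
move=> U0; apply/funext => n; rewrite /shift /conv -addnS big_split_ord/=.
rewrite big1 ?add0r => [|i _]; last by rewrite U0 ?mul0r.
by apply: eq_bigr => i _; rewrite subnDl.
Qed.

Lemma conv_eq0 m U V : (forall j, (j < m)%N -> U j = 0) ->
  forall j, (j < m)%N -> conv U V j = 0.
Proof.
move=> U0 j jm; rewrite /conv big1// => i _; rewrite U0 ?mul0r//.
by apply: leq_ltn_trans jm; rewrite -ltnS.
Qed.

(** Here [shift m] is division by [x^m]. The two factors [x^m] of [U^2 W] are removed one at a time,
    commutativity bringing the second [U] to the front. *)
Lemma conv_shift2 m U W : (forall j, (j < m)%N -> U j = 0) ->
  shift (m + m) (conv U (conv U W)) = conv (shift m U) (conv (shift m U) W) /\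
  forall j, (j < m + m)%N -> conv U (conv U W) j = 0.
Proof.
move=> U0.
have shiftE : shift m (conv U (conv U W)) = conv (conv U W) (shift m U).
  by rewrite conv_shift// convC.
split.
  transitivity (shift m (shift m (conv U (conv U W)))).
    by apply/funext => n; rewrite /shift addnA.
  by rewrite shiftE (@conv_shift m (conv U W) _ (conv_eq0 W U0)) (@conv_shift m U _ U0) convC.
move=> j jmm; have [/(conv_eq0 _ U0)//|mj] := ltnP j m.
rewrite -(subnKC mj) -/(shift m _ _) shiftE; apply: conv_eq0 (conv_eq0 _ U0) _ _.
by lia.
Qed.

(** The recursion needs all earlier coefficients, so stage [n] is a whole function, meaningful up to
    index [n]. The new coefficient solves [conv_sqrS] with [H 0 = 1]. *)
Fixpoint fps_sqrt_upto U n : nat -> C :=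
  if n is m.+1 then fun j => if (j <= m)%N then fps_sqrt_upto U m j else
    (U m.+1 - \sum_(i < m) fps_sqrt_upto U m i.+1 * fps_sqrt_upto U m (m - i)%N) / 2
  else fun=> 1.

Lemma fps_sqrt_exists U : U 0%N = 1 -> exists2 P, P 0%N = 1 & conv P P = U.
Proof.
move=> U0; pose P n := fps_sqrt_upto U n n.
have PE n j : (j <= n)%N -> fps_sqrt_upto U n j = P j.
  elim: n j => [|n IHn] j; first by rewrite leqn0 => /eqP->.
  rewrite leq_eqVlt => /predU1P[->//|]; rewrite ltnS => jn.
  by rewrite /= jn IHn.
exists P => //; apply/funext => -[|n]; first by rewrite conv0 mulr1.
rewrite conv_sqrS mulr1 {1}/P /= ltnn mulrC divfK ?pnatr_eq0//.
rewrite (eq_bigr (fun i : 'I_n => P i.+1 * P (n - i)%N)) ?subrK// => i _.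
by rewrite !PE// leq_subr.
Qed.

(** After exchanging the sums, [a i] multiplies a partial sum of [b] of length [N - i]. Bounds on
    [b] are asked only up to length [N], so that the induction in [l1_sqrt] can supply them. *)
Lemma sum_conv_le (a b : nat -> R) (M : R) N :
  (forall n, 0 <= a n) -> (forall K, (K <= N)%N -> \sum_(j < K) b j <= M) ->
  \sum_(n < N) \sum_(i < n.+1) a i * b (n - i)%N <= (\sum_(i < N) a i) * M.
Proof.
move=> a0 bM.
under eq_bigr => n _ do rewrite (big_ord_widen _ (fun i => a i * b (n - i)%N) (ltn_ord n)).
rewrite (exchange_big_dep xpredT)//= mulr_suml; apply: ler_sum => i _.
rewrite -mulr_sumr ler_wpM2l//.
rewrite -(big_mkord (fun n => (i < n.+1)%N) (fun n => b (n - i)%N)).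
rewrite (eq_bigl (fun n => true && (i <= n)%N)); last by [].
rewrite -(big_nat_widenl i 0 N xpredT)//.
rewrite -{1}[nat_of_ord i]add0n big_addn big_mkord.
under eq_bigr do rewrite addnK.
by rewrite bM// leq_subr.
Qed.

Lemma l1_conv U V : l1 U -> l1 V -> l1 (conv U V).
Proof.
move=> [MU UM] [MV VM]; exists (MU * MV) => N.
apply: (@le_trans _ _ (\sum_(n < N) \sum_(i < n.+1) normc (U i) * normc (V (n - i)%N))).
  apply: ler_sum => n _; rewrite (le_trans (ler_normc_sum _ _ _))//.
  by apply: ler_sum => i _; rewrite normcM.
apply: le_trans (sum_conv_le (a := fun n => normc (U n)) (b := fun n => normc (V n)) (N := N)
    _ (fun K _ => VM K)) _.
  by move=> n; exact: normc_ge0.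
by rewrite ler_wpM2r//; have := VM 0%N; rewrite big_ord0.
Qed.

(** Let [r = |H_0|] and [t_N = |H_1| + ... + |H_N|]. Solving the square for each coefficient and
    summing gives [2 r t_(N+1) <= r^2 + r t_N] once [t_K <= r] for all [K <= N]; hence
    [t_(N+1) <= r]. *)
Lemma l1_sqrt H : H 0%N != 0 ->
  (forall N, \sum_(n < N) normc (conv H H n.+1) <= normc (conv H H 0%N)) ->
  l1 H.
Proof.
move=> H0; rewrite conv0 normcM => HS; set r := normc (H 0%N) in HS.
have r0 : 0 < r.
  by rewrite lt_neqAle normc_ge0 andbT eq_sym; apply: contra H0 => /eqP/eq0_normc ->.
pose t N := \sum_(n < N) normc (H n.+1).
suff tr N : t N <= r.
  exists (r + r) => -[|N]; first by rewrite big_ord0 addr_ge0// normc_ge0.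
  by rewrite big_ord_recl lerD//; exact: tr.
(* All [K <= N] are treated at once because [sum_conv_le] asks for them. *)
suff: forall K, (K <= N)%N -> t K <= r by apply.
elim: N => [|N IHN] K; first by rewrite leqn0 => /eqP->; rewrite /t big_ord0 normc_ge0.
rewrite leq_eqVlt => /predU1P[->|]; last exact: IHN.
rewrite -(@ler_pM2l _ (2 * r)) ?mulr_gt0// /t mulr_sumr.
have hle n : 2 * r * normc (H n.+1) <= normc (conv H H n.+1)
    + \sum_(i < n) normc (H i.+1) * normc (H (n - i)%N).
  have -> : 2 * r * normc (H n.+1) = normc (2 * H 0%N * H n.+1).
    by rewrite !normcM; congr (_ * _ * _); rewrite -[2]/(1 *+ 2) normcMn normc1.
  have -> : 2 * H 0%N * H n.+1 = conv H H n.+1 - \sum_(i < n) H i.+1 * H (n - i)%N.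
    by rewrite conv_sqrS addrK.
  rewrite (le_trans (le_normcD _ _))// lerD2l normcN (le_trans (ler_normc_sum _ _ _))//.
  by apply: ler_sum => i _; rewrite normcM.
apply: le_trans (_ : _ <= \sum_(n < N.+1) (normc (conv H H n.+1)
    + \sum_(i < n) normc (H i.+1) * normc (H (n - i)%N))) _.
  by apply: ler_sum => n _; exact: hle.
rewrite big_split/= [leRHS](_ : _ = r * r + r * r); last by rewrite -mulrA mulrDl mul1r.
apply: lerD; first exact: HS.
(* The term [n = 0] is an empty sum; without it, the rest is the convolution of [|H_1|, |H_2|, ...]
   with itself. *)
rewrite big_ord_recl big_ord0 add0r.
rewrite (eq_bigr (fun n : 'I_N => \sum_(i < n.+1) normc (H i.+1) * normc (H (n - i).+1))).
  apply: le_trans (sum_conv_le (a := fun i => normc (H i.+1))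
    (b := fun i => normc (H i.+1)) _ IHN) _.
    by move=> n; exact: normc_ge0.
  by rewrite ler_wpM2r ?normc_ge0// IHN.
move=> n _; apply: eq_bigr => i _; congr (_ * normc (H _)).
by rewrite /= subSn// -ltnS; exact: ltn_ord i.
Qed.

(** As [W_0 = 1], [|U_n|] is at most [|(U W)_n|] plus the terms [|U_i| |W_(n-i)|] with [i < n].
    Summing, the partial sums of [|U_n|] are at most [M] plus [c] times themselves. *)
Lemma l1_divisor U W (c : R) : W 0%N = 1 -> c < 1 ->
  (forall N, \sum_(n < N) normc (W n.+1) <= c) ->
  l1 (conv U W) -> l1 U.
Proof.
move=> W0 c1 Wc [M UWM]; exists (M / (1 - c)) => N.
rewrite ler_pdivlMr ?subr_gt0// mulrBr mulr1 lerBlDr.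
(* The moduli of the coefficients of [W], with 0 as constant term to confine the convolution to
   [i < n]. *)
pose w n := if n is m.+1 then normc (W m.+1) else 0.
have wc K : \sum_(j < K) w j <= c.
  case: K => [|K]; last by rewrite big_ord_recl add0r; exact: Wc.
  by have := Wc 0%N; rewrite !big_ord0.
have := sum_conv_le (a := fun n => normc (U n)) (b := w) (N := N)
  (fun n => normc_ge0 (U n)) (fun K _ => wc K).
move=> /(lerD (UWM N)); apply: le_trans.
rewrite -big_split/=; apply: ler_sum => n _.
rewrite big_ord_recr/= subnn mulr0 addr0.
have -> : U n = conv U W n - \sum_(i < n) U i * W (n - i)%N.
  by rewrite /conv big_ord_recr/= subnn W0 mulr1 addrAC subrr add0r.
rewrite (le_trans (le_normcD _ _))// lerD2l normcN (le_trans (ler_normc_sum _ _ _))//.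
apply: ler_sum => i _; rewrite normcM.
by have := ltn_ord i; rewrite -subn_gt0; case: (n - i)%N.
Qed.

End PowerSeries.

(** * Values at 1 and Cauchy products *)

Section ValuesAt1.
Variable R : realType.
Local Notation C := (R[i]).
Implicit Types (U V : fps R).

Definition initial_segment N : {fset nat} := [fset val i | i in 'I_N]%fset.

Lemma mem_initial_segment N i : (i \in initial_segment N) = (i < N)%N.
Proof.
by apply/imfsetP/idP => [[j _ ->]|iN]; [exact: ltn_ord|exists (Ordinal iN)].
Qed.

Lemma big_initial_segment (V : zmodType) N (f : nat -> V) :
  \sum_(i <- initial_segment N | i \in [set: nat]) f i = \sum_(i < N) f i.
Proof.
rewrite (eq_bigl xpredT) => [|i]; last by rewrite in_setT.
by rewrite big_imfset/=; [rewrite big_enum|move=> ? ? _ _ /val_inj].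
Qed.

(** This turns limits along finite sets into limits of ordinary series. *)
Lemma initial_segment_cofinal (Y : {fset nat}) :
  exists N, forall M, (N <= M)%N -> (Y `<=` initial_segment M)%fset.
Proof.
exists (\max_(i <- Y) i).+1 => M NM; apply/fsubsetP => i iY.
by rewrite mem_initial_segment; apply: leq_trans NM; rewrite ltnS leq_bigmax_seq.
Qed.

Lemma l1_abs_convergent U : l1 U <-> abs_convergent [set: nat] U.
Proof.
rewrite abs_convergentP; split=> [[M UM]|[M UM]]; exists M.
  move=> Y; have [N /(_ N (leqnn _)) YN] := initial_segment_cofinal Y.
  apply: le_trans (UM N); rewrite -(big_initial_segment N (fun n => normc (U n))).
  rewrite (partial_csum_sub _ _ YN).
  by rewrite lerDl sumr_ge0// => i _; exact: normc_ge0.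
by move=> N; rewrite -(big_initial_segment N (fun n => normc (U n))).
Qed.

Lemma exists_at1_l1 U : exists_at1 U <-> l1 U.
Proof.
rewrite l1_abs_convergent /exists_at1 /abs_convergent /esum.summable.
rewrite nneseries_esumT => [|n]; last by rewrite lee_fin normc_ge0.
rewrite (@eq_esum _ _ _ (fun n => `|(normc (U n))%:E|%E) (fun n => (normc (U n))%:E))// => n _.
by rewrite gee0_abs// lee_fin normc_ge0.
Qed.

Lemma has_csum_series U s : has_csum [set: nat] U s -> series U @ \oo --> s.
Proof.
move=> Us; apply/cvg_normcP => e /Us[Y0 Y0P].
have [N NP] := initial_segment_cofinal Y0.
exists N => // M /= /NP/Y0P.
by rewrite /partial_csum big_initial_segment /series/= big_mkord.
Qed.

Lemma l1_has_csum U : l1 U -> has_csum [set: nat] U (value_at1 U).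
Proof.
move=> /l1_abs_convergent/abs_convergent_has_csum Us.
suff -> : value_at1 U = csum [set: nat] U by [].
exact: (cvg_lim (@complex_hausdorff R) (has_csum_series Us)).
Qed.

Lemma l1_series_cvg U : l1 U -> series U @ \oo --> value_at1 U.
Proof. by move=> /l1_has_csum/has_csum_series. Qed.

(** The family [U_i V_j] converges absolutely; its sum is the left side along antidiagonals and the
    right side along rows. *)
Lemma value_at1_conv U V : l1 U -> l1 V ->
  value_at1 (conv U V) = value_at1 U * value_at1 V.
Proof.
move=> Ul Vl; have Uu := l1_has_csum Ul; have Vv := l1_has_csum Vl.
pose g (x : nat * nat) := U x.1 * V x.2.
have /abs_convergent_has_csum gs : abs_convergent [set: nat * nat] g.
  move: Ul Vl => /l1_abs_convergent/abs_convergentP[MU UM].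
  move=> /l1_abs_convergent/abs_convergentP[MV VM].
  apply/abs_convergentP; exists (MU * MV) => Y.
  rewrite (eq_bigl xpredT) => [|x]; last by rewrite in_setT.
  (* Grouping [Y] by first coordinates bounds each group by [MV] times one coefficient of [U]. *)
  rewrite (partition_big_imfset _ fst).
  apply: (@le_trans _ _ (\sum_(i <- [fset x.1 | x in Y]%fset) normc (U i) * MV)).
    apply: ler_sum => i _.
    rewrite (eq_bigr (fun x => normc (U i) * normc (V x.2))); last first.
      by move=> x /eqP <-; rewrite normcM.
    rewrite -mulr_sumr ler_wpM2l ?normc_ge0//.
    apply: le_trans (VM [fset x.2 | x in [fset x in Y | x.1 == i]]%fset).
    rewrite (eq_bigl xpredT (fun i => normc (V i))) => [|x]; last by rewrite in_setT.
    rewrite big_imfset/=; last first.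
      move=> [x1 x2] [y1 y2]; rewrite !inE /= => /andP[_ /eqP->] /andP[_ /eqP->].
      by move=> ->.
    by rewrite -big_fset_condE.
  rewrite -mulr_suml ler_wpM2r//.
    by apply: le_trans (VM fset0); apply: sumr_ge0 => i _; exact: normc_ge0.
  apply: le_trans (UM [fset x.1 | x in Y]%fset).
  by rewrite [leRHS](eq_bigl xpredT)// => x; rewrite in_setT.
have fibsum : has_csum [set: nat] (conv U V) (csum [set: nat * nat] g).
  apply: (@has_csum_fibers _ _ _ [set: nat * nat] _ (fun x => (x.1 + x.2)%N) g) => // n _.
  have -> : conv U V n = \sum_(x <- [fset (val i, (n - val i)%N) | i in 'I_n.+1]%fset) g x.
    by rewrite big_imfset/=; [rewrite big_enum|move=> i j _ _ [/val_inj]].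
  apply: has_csum_fset; apply/seteqP; split=> x /=.
    move=> [_ <-]; apply/imfsetP; have xn : (x.1 < (x.1 + x.2).+1)%N by rewrite ltnS leq_addr.
    by exists (Ordinal xn) => //=; rewrite addKn -surjective_pairing.
  by move=> /imfsetP[i _ ->] /=; split=> //; rewrite subnKC// -ltnS.
have prodsum : has_csum [set: nat] (fun i => value_at1 V * U i) (csum [set: nat * nat] g).
  apply: (@has_csum_fibers _ _ _ [set: nat * nat] _ fst g) => // i _.
  apply: (@has_csum_bij _ _ _ [set: nat] _ (fun j => (i, j)) snd (fun j => U i * V j)) => //.
  - by move=> [? ?] [_ /= ->].
  - by rewrite mulrC; exact: has_csumZ.
have -> : value_at1 U * value_at1 V = csum [set: nat * nat] g.
  by rewrite mulrC; exact: has_csum_unique (has_csumZ _ Uu) prodsum.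
exact: (cvg_lim (@complex_hausdorff R) (has_csum_series fibsum)).
Qed.

End ValuesAt1.

(** * The factor [F] in a product [F^2 B] *)

Section SquareDivisor.
Variables (R : realType) (F B : fps R).
Hypothesis B0 : B 0%N = 1.
Implicit Types (n k m N : nat).

(** Divide out both factors [x^m] and compare constant terms. This is what forces the order of
    [F^2 B] to be even. *)
Lemma sqr_divisor_order m : (forall j, (j < m)%N -> F j = 0) ->
  conv F (conv F B) (m + m)%N = F m ^+ 2.
Proof.
move=> /conv_shift2-/(_ B)[/(congr1 (fun U => U 0%N)) + _].
by rewrite !conv0 B0 mulr1 /shift !addn0.
Qed.

Lemma sqr_divisor_eq0 :
  (forall n, conv F (conv F B) n = 0) -> forall n, F n = 0.
Proof.
move=> D0; elim/ltn_ind => n /sqr_divisor_order.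
by rewrite D0 => /esym/eqP; rewrite sqrf_eq0 => /eqP.
Qed.

Lemma sqr_divisor_l1 (c : R) k : c < 1 ->
  (forall N, \sum_(n < N) normc (B n.+1) <= c) ->
  conv F (conv F B) k != 0 ->
  (forall j, (j < k)%N -> conv F (conv F B) j = 0) ->
  (forall N, \sum_(n < N) normc (conv F (conv F B) (k + n.+1)%N) <=
    normc (conv F (conv F B) k)) ->
  l1 F.
Proof.
move=> c1 Bc Dk D0 Dsum.
have exF : exists m, F m != 0.
  apply: contrapT => /forallNP F0; move: Dk; rewrite /conv big1 ?eqxx// => i _.
  by have /negP/negPn/eqP -> := F0 i; rewrite mul0r.
have [m Fm Fmin] := ex_minnP exF.
have F0 j : (j < m)%N -> F j = 0.
  by move=> jm; apply/eqP/negPn/negP => /Fmin; rewrite leqNgt jm.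
have [DE Dlt] := conv_shift2 B F0.
(* A smaller [k] contradicts the vanishing below [2m]; a larger one contradicts the nonzero
   coefficient [F m ^+ 2] at [2m]. *)
have km : k = (m + m)%N.
  case: (ltngtP k (m + m)%N) => // lt; first by rewrite Dlt// eqxx in Dk.
  by have := D0 _ lt; rewrite sqr_divisor_order// => /eqP; rewrite sqrf_eq0 (negbTE Fm).
set F' := shift m F in DE.
have F'0 : F' 0%N != 0 by rewrite /F' /shift addn0.
have [P P0 PP] := fps_sqrt_exists B0.
have Pl1 : l1 P.
  apply: l1_sqrt; rewrite ?P0 ?oner_eq0// PP B0 normc1 => N.
  exact: le_trans (Bc N) (ltW c1).
(* [(F' P)^2 = F'^2 B], the shifted series that [Dsum] controls. *)
have HH : conv (conv F' P) (conv F' P) = shift k (conv F (conv F B)).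
  by rewrite km DE -PP -convA; congr conv; rewrite convC -convA.
have Hl1 : l1 (conv F' P).
  apply: l1_sqrt; first by rewrite conv0 P0 mulr1.
  move=> N; rewrite HH /shift addn0; exact: Dsum.
(* [F' B = (F' P) P] is a product of two summable series. *)
have [M F'M] : l1 F'.
  apply: (l1_divisor B0 c1 Bc).
  by rewrite -PP convA; exact: l1_conv.
exists M => N; apply: le_trans (_ : _ <= \sum_(n < m + N) normc (F n)) _.
  rewrite addnC big_split_ord/= lerDl.
  by apply: sumr_ge0 => i _; exact: normc_ge0.
rewrite big_split_ord/= big1 ?add0r => [|i _]; first exact: F'M.
by rewrite F0// normc0.
Qed.

(** Around [B_0 = 1], every nonempty partial sum has modulus at least [1 - c], so the limit cannot
    be 0. *)
Lemma value_at1_neq0 (c : R) : c < 1 ->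
  (forall N, \sum_(n < N) normc (B n.+1) <= c) -> l1 B -> value_at1 B != 0.
Proof.
move=> c1 Bc /l1_series_cvg/cvg_normcP Bcvg; apply/eqP => b0.
have [|N _ NP] := Bcvg (1 - c); first by rewrite subr_gt0.
have := NP N.+1 (leqnSn _); rewrite /= b0 subr0 /series /= big_mkord.
rewrite big_ord_recl B0 ltNge => /negP; apply.
rewrite lerBlDr -[leLHS](@normc1 R) -[X in normc X <= _](addrK (\sum_(i < N) B i.+1)).
rewrite (le_trans (le_normcD _ _))// lerD2l normcN.
exact: le_trans (ler_normc_sum _ _ _) (Bc N).
Qed.

End SquareDivisor.

Lemma nneseries_partial_le (R : realType) (u : nat -> R) (m N : nat) (x : R) :
  (forall n, 0 <= u n) -> (\sum_(m <= n <oo) (u n)%:E <= x%:E)%E ->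
  \sum_(n < N) u (m + n)%N <= x.
Proof.
move=> u0 ux; rewrite -lee_fin; apply: le_trans ux.
apply: le_trans (nneseries_lim_ge (m + N)%N _); last by move=> n _ _; rewrite lee_fin.
(* The lower bound is written [0 + m] to match [big_addn]. *)
rewrite sumEFin lee_fin [leRHS](_ : _ = \sum_(0 + m <= i < m + N) u i)//.
by rewrite big_addn addKn big_mkord; under [leRHS]eq_bigr do rewrite addnC.
Qed.

Unset Implicit Arguments.

Theorem theorem11 (R : realType) (v : vertex) (h : weight R)
    (v_neq1 : v != vertex1)
    (h_transitive : transitive_weight h v)
    (h_light : light_weight h)
    (h_convex : convex_weight h)
    (v_reachable : reachable_from1 h v)
    (Bv_at1 : exists_at1 (B_series_avoiding h v)) :
  let c := (\sum_(1 <= n <oo) (normc (B_series h n))%:E)%E in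
  (c < 1)%E ->
  (B_series_avoiding h v = B_series h -> A_series h v = (fun=> 0)) /\
  (B_series_avoiding h v <> B_series h ->
   forall k : nat,
     B_series_avoiding h v k != B_series h k ->
     (forall j : nat, (j < k)%N -> B_series_avoiding h v j = B_series h j) ->
     (((normc (B_series_avoiding h v k - B_series h k) * (1 - fine c))^-1)%:E *
        \sum_(k.+1 <= n <oo) (normc (B_series_avoiding h v n - B_series h n))%:E < 1)%E ->
     [/\ exists_at1 (B_series h), value_at1 (B_series h) != 0
       & exists2 l : R[i],
           A_series h v n @[n --> \oo] --> l
           & square_roots (1 - value_at1 (B_series_avoiding h v) / value_at1 (B_series h)) l]).
Proof.
move=> c c_lt1.
have [/(_ h_convex) AE CE DE] := first_passage_identities h_transitive h_light.
set F := first_passage_series h v in AE CE DE.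
set B := B_series h; set Bv := B_series_avoiding h v.
have B0 : B 0%N = 1 by exact: B_series0.
have {CE DE}DE n : B n - Bv n = conv F (conv F B) n.
  by rewrite DE; apply: eq_bigr => i _; rewrite CE.
have c_ge0 : (0 <= c)%E by apply: nneseries_ge0 => n _ _; rewrite lee_fin normc_ge0.
have c_fin : c \is a fin_num by rewrite ge0_fin_numE// (lt_trans c_lt1)// ltry.
have c1 : fine c < 1 by rewrite -lte_fin fineK.
have Bc N : \sum_(n < N) normc (B n.+1) <= fine c.
  apply: (@nneseries_partial_le _ (fun n => normc (B n)) 1%N) => [n|].
    exact: normc_ge0.
  by rewrite fineK.
have c0 : 0 <= fine c by rewrite fine_ge0.
split=> [BvB|_ k Bk Bj].
  apply/funext => n; rewrite AE big1// => i _; apply: (sqr_divisor_eq0 B0) => m.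
  by rewrite -DE BvB subrr.
have normD n : normc (B n - Bv n) = normc (Bv n - B n) by rewrite normc_distC.
(* The denominator is positive, as [B] and [Bv] differ at [k] and [c < 1]. *)
rewrite lte_pdivrMl ?mule1; last first.
  rewrite mulr_gt0 ?subr_gt0// lt_neqAle normc_ge0 andbT eq_sym.
  by apply: contra Bk => /eqP/eq0_normc/eqP; rewrite subr_eq0.
move=> /ltW/nneseries_partial_le Dsum.
have Fl1 : l1 F.
  apply: (sqr_divisor_l1 B0 c1 Bc (k := k)).
  - by rewrite -DE subr_eq0 eq_sym.
  - by move=> j jk; rewrite -DE Bj// subrr.
  move=> N; rewrite -DE normD.
  (* As [0 <= c], the factor [1 - c] is at most 1. *)
  apply: (@le_trans _ _ (normc (Bv k - B k) * (1 - fine c))).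
    apply: le_trans (Dsum N (fun n => normc_ge0 _)).
    by apply: ler_sum => n _; rewrite -DE normD addnS.
  by rewrite ler_piMr ?normc_ge0// gerBl.
have Bl1 : l1 B.
  exists (1 + fine c) => -[|N]; first by rewrite big_ord0 addr_ge0.
  by rewrite big_ord_recl B0 normc1 lerD2l.
have Bneq0 := value_at1_neq0 B0 c1 Bc Bl1.
split=> //; first exact/exists_at1_l1.
exists (value_at1 F).
  (* [a_n] sums [n.+1] coefficients of [F] while [series F n] sums [n], hence the shift. *)
  rewrite (_ : A_series h v = fun n => series F n.+1).
    by rewrite (cvg_shiftS (series F)); exact: l1_series_cvg.
  by apply/funext => n; rewrite AE /series /= big_mkord.
have FFB : value_at1 F * (value_at1 F * value_at1 B) = value_at1 B - value_at1 Bv.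
  rewrite -(value_at1_conv Fl1 Bl1) -(value_at1_conv Fl1 (l1_conv Fl1 Bl1)).
  rewrite (_ : conv F (conv F B) = fun n => B n - Bv n); last by apply/funext.
  apply: (cvg_lim (@complex_hausdorff R)).
  rewrite (_ : series _ = series B \- series Bv).
    apply: cvgB; apply: l1_series_cvg => //.
    exact/exists_at1_l1.
  by apply/funext => n; rewrite /series /= sumrB.
(* Multiplying by [B(1)], which is nonzero, reduces the claim to [FFB]. *)
rewrite /square_roots /=; apply: (mulIf Bneq0).
by rewrite expr2 -mulrA FFB mulrBl mul1r divfK.
Qed.
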